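(* Let $1 \leq p < \infty$ and let $E$ and $F$ be Banach lattices. If the adjoint $T^*\colon F^*\to E^*$ of every positive order weakly compact operator $T \colon E \to F$ is disjoint $p$-convergent, then $E^*$ has order continuous norm or $F^*$ has the positive Schur property of order $p$.
   Context: All operators are linear and bounded. A sequence $(x_n)_n$ in a Banach lattice is disjoint if $|x_n|\wedge|x_m|=0$ for $n\neq m$. A sequence $(x_n)_n$ in a Banach space $Z$ is weakly $p$-summable if $(x^*(x_n))_n \in \ell_p$ for every $x^* \in Z^*$. A linear operator from a Banach lattice to a Banach space is disjoint $p$-convergent if it sends disjoint weakly $p$-summable sequences to norm null sequences. A linear operator $T$ from a Banach lattice $E$ to a Banach space $Y$ is order weakly compact if $T([0,x])$ is a relatively weakly compact subset of $Y$ for every $x\in E^+$; equivalently, if $\|T(x_n)\|\to 0$ for every order bounded disjoint sequence $(x_n)_n\subset E$. A Banach lattice $E$ has the positive Schur property of order $p$ if every weakly $p$-summable sequence $(x_n)_n\subseteq E^+$ is norm null. *)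

(* Defs.v *)
From HB Require Import structures.
From mathcomp Require Import all_boot all_order all_algebra.
From mathcomp Require Import all_classical all_reals all_analysis.

Set Implicit Arguments.
Unset Strict Implicit.
Unset Printing Implicit Defensive.

Import Order.TTheory GRing.Theory Num.Theory.
Import numFieldNormedType.Exports.

Local Open Scope classical_set_scope.
Local Open Scope order_scope.
Local Open Scope ring_scope.

(* Continuity is equivalent to boundedness, cf. linear_bounded_continuous. *)
Record boundedOp (R : realType) (V W : normedModType R) := BoundedOp {
  boundedOp_fun :> V -> W;
  boundedOp_linear : linear boundedOp_fun;
  boundedOp_continuous : continuous boundedOp_fun }.

Section bounded_operators.
Context {R : realType} {V W : normedModType R}.
Implicit Types f g h : boundedOp V W.

HB.instance Definition _ f := GRing.isLinear.Build R V W _ f (boundedOp_linear f).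

Lemma boundedOpP f g : (forall x, f x = g x) -> f = g.
Proof.
case: f g => [f fl fc] [g gl gc] /= /funext fg.
by subst g; rewrite (Prop_irrelevance fl gl) (Prop_irrelevance fc gc).
Qed.

HB.instance Definition _ := gen_eqMixin (boundedOp V W).
HB.instance Definition _ := gen_choiceMixin (boundedOp V W).

Let zeroL : linear (fun _ : V => 0 : W).
Proof. by move=> a x y; rewrite scaler0 addr0. Qed.
Let zeroC : continuous (fun _ : V => 0 : W).
Proof. by move=> x; exact: cvg_cst. Qed.
Let addL f g : linear (fun x => f x + g x).
Proof. by move=> a x y; rewrite !linearP scalerDr addrACA. Qed.
Let addC f g : continuous (fun x => f x + g x).
Proof. by move=> x; apply: cvgD; exact: boundedOp_continuous. Qed.
Let oppL f : linear (fun x => - f x).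
Proof. by move=> a x y; rewrite linearP opprD scalerN. Qed.
Let oppC f : continuous (fun x => - f x).
Proof. by move=> x; apply: cvgN; exact: boundedOp_continuous. Qed.
Let scaleL (k : R) f : linear (fun x => k *: f x).
Proof. by move=> a x y; rewrite linearP scalerDr !scalerA mulrC. Qed.
Let scaleC (k : R) f : continuous (fun x => k *: f x).
Proof. by move=> x; apply: cvgZr; exact: boundedOp_continuous. Qed.

Definition op_zero := BoundedOp zeroL zeroC.
Definition op_add f g := BoundedOp (addL f g) (@addC f g).
Definition op_opp f := BoundedOp (oppL f) (@oppC f).
Definition op_scale k f := BoundedOp (scaleL k f) (@scaleC k f).

Let op_addA : associative op_add.
Proof. by move=> f g h; apply/boundedOpP => x /=; rewrite addrA. Qed.
Let op_addC : commutative op_add.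
Proof. by move=> f g; apply/boundedOpP => x /=; rewrite addrC. Qed.
Let op_add0 : left_id op_zero op_add.
Proof. by move=> f; apply/boundedOpP => x /=; rewrite add0r. Qed.
Let op_addN : left_inverse op_zero op_opp op_add.
Proof. by move=> f; apply/boundedOpP => x /=; rewrite addNr. Qed.

HB.instance Definition _ :=
  GRing.isZmodule.Build (boundedOp V W) op_addA op_addC op_add0 op_addN.

Let op_scaleA a b f : op_scale a (op_scale b f) = op_scale (a * b) f.
Proof. by apply/boundedOpP => x /=; rewrite scalerA. Qed.
Let op_scale1 : left_id 1 op_scale.
Proof. by move=> f; apply/boundedOpP => x /=; rewrite scale1r. Qed.
Let op_scaleDr : right_distributive op_scale +%R.
Proof. by move=> a f g; apply/boundedOpP => x /=; rewrite scalerDr. Qed.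
Let op_scaleDl f : {morph op_scale^~ f : a b / a + b}.
Proof. by move=> a b; apply/boundedOpP => x /=; rewrite scalerDl. Qed.

HB.instance Definition _ := GRing.Zmodule_isLmodule.Build R (boundedOp V W)
  op_scaleA op_scale1 op_scaleDr op_scaleDl.

Lemma boundedOpD f g x : (f + g) x = f x + g x. Proof. by []. Qed.
Lemma boundedOpN f x : (- f) x = - f x. Proof. by []. Qed.
Lemma boundedOpB f g x : (f - g) x = f x - g x. Proof. by []. Qed.
Lemma boundedOpZ a f x : (a *: f) x = a *: f x. Proof. by []. Qed.

Definition opnorm f : R := sup [set `|f x| | x in [set x | `|x| <= 1]].

Lemma boundedOp_bound f : exists2 M, 0 <= M & forall x, `|f x| <= M * `|x|.
Proof.
have /linear_bounded_continuous/linear_boundedP := @boundedOp_continuous _ _ _ f.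
by case/pinfty_ex_gt0 => M M0 fM; exists M => //; exact: ltW.
Qed.

Let opnorm_has_sup f : has_sup [set `|f x| | x in [set x | `|x| <= 1]].
Proof.
split; first by exists `|f 0|; exists 0 => //=; rewrite normr0.
have [M M0 fM] := boundedOp_bound f; exists M => _ [x /= x1 <-].
by apply: (le_trans (fM x)); rewrite ler_piMr.
Qed.

Lemma opnorm_ge0 f : 0 <= opnorm f.
Proof.
apply: (@le_trans _ _ `|f 0|) => //.
by apply: sup_upper_bound => //; exists 0 => //=; rewrite normr0.
Qed.

Lemma ler_opnorm f x : `|f x| <= opnorm f * `|x|.
Proof.
have [->|x0] := eqVneq x 0; first by rewrite linear0 !normr0 mulr0.
have nx : 0 < `|x| by rewrite normr_gt0.
rewrite -ler_pdivrMr //.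
suff -> : `|f x| / `|x| = `|f (`|x|^-1 *: x)|.
  apply: sup_upper_bound => //; exists (`|x|^-1 *: x) => //=.
  by rewrite normrZ normfV normr_id mulVf // gt_eqF.
by rewrite linearZ normrZ normfV normr_id mulrC.
Qed.

Lemma opnorm_le f M : 0 <= M -> (forall x, `|f x| <= M * `|x|) -> opnorm f <= M.
Proof.
move=> M0 fM; apply: ge_sup; first by have [] := opnorm_has_sup f.
by move=> _ [x /= x1 <-]; apply: (le_trans (fM x)); rewrite ler_piMr.
Qed.

Let opnormD f g : opnorm (f + g) <= opnorm f + opnorm g.
Proof.
apply: opnorm_le => [|x]; first by rewrite addr_ge0 // opnorm_ge0.
by rewrite mulrDl (le_trans (ler_normD _ _)) // lerD // ler_opnorm.
Qed.

Let opnormZ_le (k : R) f : opnorm (k *: f) <= `|k| * opnorm f.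
Proof.
apply: opnorm_le => [|x]; first by rewrite mulr_ge0 // opnorm_ge0.
by rewrite boundedOpZ normrZ -mulrA ler_wpM2l // ler_opnorm.
Qed.

Let opnormZ (k : R) f : opnorm (k *: f) = `|k| * opnorm f.
Proof.
apply/eqP; rewrite eq_le opnormZ_le /=.
have [->|k0] := eqVneq k 0; first by rewrite normr0 mul0r opnorm_ge0.
rewrite -ler_pdivlMl ?normr_gt0 // -normfV.
by rewrite -{1}(scale1r f) -(mulVf k0) -scalerA opnormZ_le.
Qed.

Let opnorm0_eq0 f : opnorm f = 0 -> f = 0.
Proof.
move=> f0; apply/boundedOpP => x; apply/eqP; rewrite -normr_le0.
by have := ler_opnorm f x; rewrite f0 mul0r.
Qed.

HB.instance Definition _ := Lmodule_isNormed.Build R (boundedOp V W)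
  opnormD opnormZ opnorm0_eq0.

Lemma boundedOp_normE f : `|f| = opnorm f. Proof. by []. Qed.

Lemma ler_boundedOp f x : `|f x| <= `|f| * `|x|.
Proof. exact: ler_opnorm. Qed.

Lemma boundedOp_norm_le f M :
  0 <= M -> (forall x, `|f x| <= M * `|x|) -> `|f| <= M.
Proof. exact: opnorm_le. Qed.

End bounded_operators.

Section boundedOp_complete.
Context {R : realType} {V : normedModType R} {W : completeNormedModType R}.

Lemma linear_bound_continuous (f : V -> W) (M : R) :
  linear f -> (forall x, `|f x| <= M * `|x|) -> continuous f.
Proof.
move=> fl fM.
pose fL : {linear V -> W} := HB.pack f (GRing.isLinear.Build R V W _ f fl).
apply: (@bounded_linear_continuous _ _ _ fL); apply/linear_boundedP.
near=> r => x; rewrite (le_trans (fM x)) // ler_wpM2r //.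
Unshelve. all: by end_near. Qed.

Let op_cvg (F : set_system (boundedOp V W)) :
  ProperFilter F -> cauchy F -> cvg F.
Proof.
move=> FF /cauchy_ballP Fc.
have Fe e : 0 < e -> \forall f & g \near F, forall x : V,
    `|(f : boundedOp V W) x - (g : boundedOp V W) x| <= e * `|x|.
  move=> e0; apply: filterS (Fc e e0) => -[f g] /=; rewrite -ball_normE /= => fg x.
  by rewrite -boundedOpB (le_trans (ler_boundedOp _ _)) // ler_wpM2r // ltW.
have cvx x : cvg ((f : boundedOp V W) x @[f --> F]).
  apply: cauchy_cvg; apply/cauchy_ballP => e e0.
  have e1 : 0 < e / (`|x| + 1) by rewrite divr_gt0 // ltr_wpDl.
  have := Fe _ e1; rewrite !near_simpl => -[[A B] /= [FA FB] AB].
  exists ([set f x | f in A], [set f x | f in B]) => /=.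
    split; [apply: filterS FA|apply: filterS FB] => f ?; by exists f.
  move=> [_ _] /= [[f Af <-] [g Bg <-]]; rewrite -ball_normE /=.
  apply: (le_lt_trans (AB (f, g) (conj Af Bg) x)).
  by rewrite mulrAC ltr_pdivrMr ?ltr_wpDl // ltr_pM2l // ltrDl.
pose L x : W := lim ((f : boundedOp V W) x @[f --> F]).
have LE x : (f : boundedOp V W) x @[f --> F] --> L x by exact: cvx.
have Ll : linear L.
  move=> a x y; apply: cvg_lim => //.
  have -> : (fun f : boundedOp V W => f (a *: x + y)) =
            (fun f => a *: f x + f y) by apply/funext => f; rewrite linearP.
  by apply: cvgD; [apply: cvgZr|]; exact: LE.
have LF e : 0 < e -> \forall f \near F, forall x,
    `|L x - (f : boundedOp V W) x| <= e * `|x|.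
  move=> e0; have := Fe _ e0; rewrite !near_simpl => -[[A B] /= [FA FB] AB].
  apply: filterS FA => f Af x.
  have : (`|g x - f x|) @[g --> F] --> `|L x - f x|.
    by apply: cvg_norm; apply: cvgB; [exact: LE|exact: cvg_cst].
  move=> /(@cvgr_to_le _ _ _ _ _ _ (e * `|x|)); apply.
  by apply: filterS FB => g Bg; rewrite distrC; exact: (AB (f, g)).
have [f0 f0L] := filter_ex (LF 1 ltr01).
have [M M0 f0M] := boundedOp_bound f0.
have LM x : `|L x| <= (1 + M) * `|x|.
  rewrite -(subrK (f0 x) (L x)) (le_trans (ler_normD _ _)) // mulrDl lerD //.
have Lc := linear_bound_continuous Ll LM.
apply/cvg_ex; exists (BoundedOp Ll Lc).
apply/cvgrPdist_le => e e0; apply: filterS (LF e e0) => f fL.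
by apply: boundedOp_norm_le; [exact: ltW|exact: fL].
Qed.

HB.instance Definition _ := Uniform_isComplete.Build (boundedOp V W) op_cvg.

End boundedOp_complete.

(* The order and the lattice operations are fields of this mixin because HB
   rejects a structure joining NormedModule and Order.Lattice: both are
   already inherited by Num.RealDomain.  The library's order structures (for
   ring_display) are derived from it below. *)
HB.mixin Record CompleteNormedModule_isBanachLattice (R : realType) E
    & CompleteNormedModule R E := {
  vle : rel E;
  vmeet : E -> E -> E;
  vjoin : E -> E -> E;
  vle_refl : reflexive vle;
  vle_anti : antisymmetric vle;
  vle_trans : transitive vle;
  vle_meet : forall x y z, vle x (vmeet y z) = vle x y && vle x z;
  vge_join : forall x y z, vle (vjoin x y) z = vle x z && vle y z;
  vleD2r : forall z x y, vle x y -> vle (x + z) (y + z);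
  vleZ_ge0 : forall (a : R) x, 0 <= a -> vle 0 x -> vle 0 (a *: x);
  vnorm_mono : forall x y,
    vle (vjoin x (- x)) (vjoin y (- y)) -> `|x| <= `|y| }.

#[short(type="banachLatticeType")]
HB.structure Definition BanachLattice (R : realType) :=
  { E of CompleteNormedModule R E & CompleteNormedModule_isBanachLattice R E }.

Section banach_lattice_order.
Context (R : realType) (E : banachLatticeType R).

#[non_forgetful_inheritance]
HB.instance Definition _ := Order.Le_isPOrder.Build ring_display
  (BanachLattice.sort E) (@vle_refl R E) (@vle_anti R E) (@vle_trans R E).

#[non_forgetful_inheritance]
HB.instance Definition _ := Order.POrder_MeetJoin_isLattice.Build ring_display
  (BanachLattice.sort E) (@vle_meet R E) (@vge_join R E).
End banach_lattice_order.

Definition modulus (R : realType) (E : banachLatticeType R) (x : E) : E :=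
  x `|` (- x).

Section banach_lattice_theory.
Context {R : realType} {E : banachLatticeType R}.
Implicit Types x y z : E.

Lemma bl_leD2r z x y : x <= y -> x + z <= y + z.
Proof. exact: vleD2r. Qed.
Lemma bl_lerD2r z x y : (x + z <= y + z) = (x <= y).
Proof.
apply/idP/idP; last exact: bl_leD2r.
by move=> /(bl_leD2r (- z)); rewrite !addrK.
Qed.
Lemma bl_lerD2l z x y : (z + x <= z + y) = (x <= y).
Proof. by rewrite ![z + _]addrC bl_lerD2r. Qed.
Lemma bl_subr_ge0 x y : (0 <= y - x) = (x <= y).
Proof. by rewrite -(bl_lerD2r x 0 (y - x)) add0r subrK. Qed.
Lemma bl_lerD x y z t : x <= y -> z <= t -> x + z <= y + t.
Proof.
by move=> xy zt; rewrite (@le_trans _ _ (y + z)) ?bl_lerD2r ?bl_lerD2l.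
Qed.
Lemma bl_addr_ge0 x y : 0 <= x -> 0 <= y -> 0 <= x + y.
Proof. by move=> x0 y0; rewrite -[0]addr0 bl_lerD. Qed.
Lemma bl_lerN2 x y : (- x <= - y) = (y <= x).
Proof. by rewrite -(bl_subr_ge0 (- x)) opprK addrC bl_subr_ge0. Qed.
Lemma bl_scaler_ge0 (a : R) x : 0 <= a -> 0 <= x -> 0 <= a *: x.
Proof. exact: vleZ_ge0. Qed.
Lemma bl_ler_wpZ (a : R) x y : 0 <= a -> x <= y -> a *: x <= a *: y.
Proof. by move=> a0 xy; rewrite -bl_subr_ge0 -scalerBr bl_scaler_ge0 // bl_subr_ge0. Qed.

Lemma norm_modulus_mono x y : modulus x <= modulus y -> `|x| <= `|y|.
Proof. exact: vnorm_mono. Qed.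
Lemma ler_modulus x : x <= modulus x. Proof. exact: leUl. Qed.
Lemma lerN_modulus x : - x <= modulus x. Proof. exact: leUr. Qed.
Lemma modulus_le x y : (modulus x <= y) = (x <= y) && (- x <= y).
Proof. exact: leUx. Qed.

Lemma half_split x : x = 2^-1 *: (x + x).
Proof. by rewrite -mulr2n -[x *+ 2]scaler_nat scalerA mulVf // scale1r. Qed.

Lemma modulus_ge0 x : 0 <= modulus x.
Proof.
rewrite (half_split (modulus x)) bl_scaler_ge0 //.
by rewrite -(subrr x) bl_lerD // ?ler_modulus ?lerN_modulus.
Qed.
Lemma ger0_modulus x : 0 <= x -> modulus x = x.
Proof.
move=> x0; apply/le_anti; rewrite ler_modulus modulus_le lexx /= andbT.
by rewrite (le_trans _ x0) // -oppr0 bl_lerN2.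
Qed.
Lemma norm_modulus x : `|modulus x| = `|x|.
Proof.
have e := ger0_modulus (modulus_ge0 x).
by apply/le_anti; rewrite !norm_modulus_mono // e.
Qed.
Lemma bl_norm_le x y : 0 <= x -> x <= y -> `|x| <= `|y|.
Proof.
move=> x0 xy; apply: norm_modulus_mono; rewrite !ger0_modulus //.
exact: le_trans xy.
Qed.

(* The positive and negative parts of x. *)
Definition ppart x := 2^-1 *: (modulus x + x).
Definition npart x := 2^-1 *: (modulus x - x).
Lemma ppart_ge0 x : 0 <= ppart x.
Proof.
by rewrite bl_scaler_ge0 // -[x in _ + x]opprK bl_subr_ge0 lerN_modulus.
Qed.
Lemma npart_ge0 x : 0 <= npart x.
Proof. by rewrite bl_scaler_ge0 // bl_subr_ge0 ler_modulus. Qed.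
Lemma ppartB x : ppart x - npart x = x.
Proof.
by rewrite -scalerBr opprB [x - _]addrC addrACA subrr add0r -half_split.
Qed.
Lemma ppartD x : ppart x + npart x = modulus x.
Proof.
by rewrite -scalerDr addrACA subrr addr0 -half_split.
Qed.
Lemma norm_ppart x : `|ppart x| <= `|x|.
Proof.
rewrite -(norm_modulus x) bl_norm_le ?ppart_ge0 //.
by rewrite -ppartD -[leLHS]addr0 bl_lerD2l npart_ge0.
Qed.
Lemma norm_npart x : `|npart x| <= `|x|.
Proof.
rewrite -(norm_modulus x) bl_norm_le ?npart_ge0 //.
by rewrite -ppartD -[leLHS]add0r bl_lerD2r ppart_ge0.
Qed.

Lemma riesz_decomposition x y z : 0 <= x -> 0 <= y -> 0 <= z -> z <= x + y ->
  exists a b, [/\ 0 <= a, a <= x, 0 <= b, b <= y & z = a + b].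
Proof.
move=> x0 y0 z0 zxy; exists (z `&` x), (z - (z `&` x)); split.
- by rewrite lexI z0 x0.
- exact: leIr.
- by rewrite bl_subr_ge0 leIl.
- have h : z - y <= z `&` x.
    rewrite lexI -(bl_lerD2r y (z - y) z) -(bl_lerD2r y (z - y) x) subrK zxy andbT.
    by rewrite -[leLHS]addr0 bl_lerD2l.
  rewrite -(bl_lerD2r (z `&` x) (z - _) y) subrK [y + _]addrC.
  by rewrite -(bl_lerD2r (- y) z (_ + y)) addrK.
- by rewrite addrC subrK.
Qed.
End banach_lattice_theory.

Definition dual (R : realType) (V : normedModType R) : Type :=
  boundedOp V R^o.

Section dual_lattice.
Context {R : realType} {E : banachLatticeType R}.
Implicit Types (f g h : boundedOp E R^o) (x y z : E).

Definition dual_le f g := `[< forall x, 0 <= x -> (f x : R) <= g x >].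

Lemma dual_leP f g : reflect (forall x, 0 <= x -> (f x : R) <= g x) (dual_le f g).
Proof. exact: asboolP. Qed.

Let dual_le_refl : reflexive dual_le.
Proof. by move=> f; apply/dual_leP. Qed.
Let dual_le_anti : antisymmetric dual_le.
Proof.
move=> f g /andP[/dual_leP fg /dual_leP gf]; apply/boundedOpP => x.
have e y : 0 <= y -> f y = g y by move=> y0; apply/le_anti; rewrite fg ?gf.
by rewrite -(ppartB x) !linearB /= !e ?ppart_ge0 ?npart_ge0.
Qed.
Let dual_le_trans : transitive dual_le.
Proof.
move=> g f h /dual_leP fg /dual_leP gh; apply/dual_leP => x x0.
exact: le_trans (fg _ x0) (gh _ x0).
Qed.

(* Riesz-Kantorovich: on x >= 0, the positive part of f is
   sup {f y | 0 <= y <= x}; then f \/ g = g + (f - g)^+. *)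
Definition cone_sup f x : R := sup [set (f y : R) | y in [set y | 0 <= y <= x]].

Let cone_has_sup f x : 0 <= x ->
  has_sup [set (f y : R) | y in [set y | 0 <= y <= x]].
Proof.
move=> x0; split; first by exists (f 0), 0 => //=; rewrite lexx x0.
exists (`|f| * `|x|) => _ [y /= /andP[y0 yx] <-].
rewrite (le_trans (ler_norm _)) // (le_trans (ler_boundedOp _ _)) //.
by rewrite ler_wpM2l // bl_norm_le.
Qed.

Let cone_sup_ub f x y : 0 <= y -> y <= x -> (f y : R) <= cone_sup f x.
Proof.
move=> y0 yx; apply: sup_upper_bound; first exact/cone_has_sup/(le_trans y0).
by exists y => //=; rewrite y0.
Qed.

Let cone_sup_le f x (M : R) : 0 <= x ->
  (forall y, 0 <= y -> y <= x -> (f y : R) <= M) -> cone_sup f x <= M.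
Proof.
move=> x0 fM; apply: ge_sup; first by have [] := cone_has_sup f x0.
by move=> _ [y /= /andP[y0 yx] <-]; exact: fM.
Qed.

Let cone_supD f x y : 0 <= x -> 0 <= y ->
  cone_sup f (x + y) = cone_sup f x + cone_sup f y.
Proof.
move=> x0 y0; apply/le_anti/andP; split.
  apply: cone_sup_le => [|z z0 zxy]; first exact: bl_addr_ge0.
  have [a [b [a0 ax b0 yb ->]]] := riesz_decomposition x0 y0 z0 zxy.
  by rewrite linearD lerD // cone_sup_ub.
rewrite -lerBrDr; apply: cone_sup_le => // a a0 ax.
rewrite lerBrDl -lerBrDr; apply: cone_sup_le => // b b0 yb.
rewrite lerBrDr -(linearD f) cone_sup_ub //; first exact: bl_addr_ge0.
by rewrite addrC bl_lerD.
Qed.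

Let cone_supZ f (a : R) x : 0 <= a -> 0 <= x ->
  cone_sup f (a *: x) = a * cone_sup f x.
Proof.
have le b y : 0 < b -> 0 <= y -> cone_sup f (b *: y) <= b * cone_sup f y.
  move=> b0 y0; apply: cone_sup_le; first by rewrite bl_scaler_ge0 // ltW.
  move=> z z0 zby; rewrite -ler_pdivrMl //.
  have -> : b^-1 * f z = f (b^-1 *: z) by rewrite linearZ.
  have b'0 : 0 <= b^-1 by rewrite invr_ge0 ltW.
  apply: cone_sup_ub; first exact: bl_scaler_ge0.
  by rewrite (le_trans (bl_ler_wpZ b'0 zby)) // scalerA mulVf ?scale1r ?gt_eqF.
rewrite le_eqVlt => /predU1P[<- x0|a0 x0].
  have f0 : cone_sup f 0 = cone_sup f 0 + cone_sup f 0 by rewrite -cone_supD ?addr0.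
  by apply: (addrI (cone_sup f 0)); rewrite scale0r mul0r addr0 -f0.
apply/le_anti; rewrite le //= -ler_pdivlMl //.
have ax0 : 0 <= a *: x by rewrite bl_scaler_ge0 // ltW.
have ai : 0 < a^-1 by rewrite invr_gt0.
by have := le _ _ ai ax0; rewrite scalerA mulVf ?gt_eqF // scale1r.
Qed.

Let pos_fun f x : R := cone_sup f (ppart x) - cone_sup f (npart x).

Let pos_funB f a b : 0 <= a -> 0 <= b ->
  pos_fun f (a - b) = cone_sup f a - cone_sup f b.
Proof.
move=> a0 b0; rewrite /pos_fun; set x := a - b.
apply/eqP; rewrite subr_eq addrAC eq_sym subr_eq -!cone_supD ?ppart_ge0 ?npart_ge0 //.
apply/eqP; congr cone_sup.
by rewrite -[in RHS](subrK (npart x) (ppart x)) ppartB /x addrAC subrK.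
Qed.

Let pos_funE f x : 0 <= x -> pos_fun f x = cone_sup f x.
Proof.
move=> x0; rewrite -[x in LHS]subr0 pos_funB //.
have f0 : cone_sup f 0 = cone_sup f 0 + cone_sup f 0 by rewrite -cone_supD ?addr0.
rewrite [X in _ - X](_ : _ = 0) ?subr0 //.
by apply: (addrI (cone_sup f 0)); rewrite addr0 -f0.
Qed.

Let pos_linear f : linear (pos_fun f : E -> R^o).
Proof.
have pD x y : pos_fun f (x + y) = pos_fun f x + pos_fun f y.
  have [ux vx uy vy] := And4 (ppart_ge0 x) (npart_ge0 x) (ppart_ge0 y) (npart_ge0 y).
  rewrite -{1}(ppartB x) -{1}(ppartB y) addrACA -opprD pos_funB ?bl_addr_ge0 //.
  by rewrite !cone_supD // opprD addrACA.
have pZ (a : R) x : 0 <= a -> pos_fun f (a *: x) = a * pos_fun f x.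
  move=> a0; have [ux vx] := conj (ppart_ge0 x) (npart_ge0 x).
  rewrite -{1}(ppartB x) scalerBr pos_funB ?(bl_scaler_ge0 a0) //.
  by rewrite !(cone_supZ f a0) // -mulrBr.
have pN x : pos_fun f (- x) = - pos_fun f x.
  by rewrite -{1}(ppartB x) opprB pos_funB ?ppart_ge0 ?npart_ge0 // opprB.
move=> a x y; rewrite pD; congr (_ + _).
case: (leP 0 a) => [|/ltW a0]; first exact: pZ.
by rewrite -[a]opprK scaleNr pN pZ ?oppr_ge0 // -mulNr.
Qed.

Let pos_bound f x : `|pos_fun f x : R^o| <= (`|f| + `|f|) * `|x|.
Proof.
have cb y : 0 <= y -> `|cone_sup f y| <= `|f| * `|y|.
  move=> y0; rewrite ger0_norm; last first.
    by rewrite -[leLHS](linear0 f) cone_sup_ub.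
  apply: cone_sup_le => // z z0 zy.
  rewrite (le_trans (ler_norm _)) // (le_trans (ler_boundedOp _ _)) //.
  by rewrite ler_wpM2l // bl_norm_le.
rewrite (le_trans (ler_normB _ _)) // mulrDl lerD //.
  by rewrite (le_trans (cb _ (ppart_ge0 _))) // ler_wpM2l // norm_ppart.
by rewrite (le_trans (cb _ (npart_ge0 _))) // ler_wpM2l // norm_npart.
Qed.

Definition dual_pos f : boundedOp E R^o :=
  BoundedOp (pos_linear f) (linear_bound_continuous (pos_linear f) (pos_bound f)).

Lemma dual_posE f x : 0 <= x -> dual_pos f x = cone_sup f x.
Proof. exact: pos_funE. Qed.

Definition dual_join f g := g + dual_pos (f - g).
Definition dual_meet f g := - dual_join (- f) (- g).

Let dual_ge_join f g h : dual_le (dual_join f g) h = dual_le f h && dual_le g h.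
Proof.
apply/dual_leP/andP => [jh|[/dual_leP fh /dual_leP gh] x x0].
  split; apply/dual_leP => x x0; apply: le_trans (jh x x0);
    rewrite boundedOpD dual_posE //.
  - by rewrite -lerBlDl -boundedOpB cone_sup_ub.
  - by rewrite lerDl -[leLHS](linear0 (f - g)) cone_sup_ub.
rewrite boundedOpD dual_posE // -lerBrDl; apply: cone_sup_le => // y y0 yx.
rewrite boundedOpB (@le_trans _ _ (h y - g y)) ?lerD2r ?fh //.
have le (a b c d : R) : a - b <= c - d -> d - b <= c - a.
  by rewrite lerBrDr addrAC lerBlDr => h1; rewrite lerBrDr addrAC lerBlDr addrC.
by apply: le; rewrite -!linearB /= gh // bl_subr_ge0.
Qed.

Let dual_le_meet f g h : dual_le f (dual_meet g h) = dual_le f g && dual_le f h.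
Proof.
have leN a b : dual_le (- a) (- b) = dual_le b a.
  by apply/dual_leP/dual_leP => ab x x0; have := ab x x0; rewrite !boundedOpN lerN2.
by rewrite -{1}[f]opprK leN dual_ge_join !leN.
Qed.

Let dual_leD2r h f g : dual_le f g -> dual_le (f + h) (g + h).
Proof. by move=> /dual_leP fg; apply/dual_leP => x x0; rewrite lerD2r fg. Qed.

Let dual_leZ_ge0 (a : R) f : 0 <= a -> dual_le 0 f -> dual_le 0 (a *: f).
Proof.
by move=> a0 /dual_leP f0; apply/dual_leP => x x0; rewrite mulr_ge0 // f0.
Qed.

Let dual_abs_ge f x : 0 <= x ->
  ((f x : R) <= dual_join f (- f) x) /\ (- (f x : R) <= dual_join f (- f) x).
Proof.
move=> x0; have := dual_ge_join f (- f) (dual_join f (- f)).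
by rewrite dual_le_refl => /esym/andP[/dual_leP/(_ x x0) ? /dual_leP/(_ x x0)].
Qed.

Let ler_dual_abs f x : `|f x| <= (dual_join f (- f) (modulus x) : R).
Proof.
have [u1 u2] := dual_abs_ge f (ppart_ge0 x).
have [v1 v2] := dual_abs_ge f (npart_ge0 x).
rewrite -ppartD linearD -{1}(ppartB x) linearB /= ler_norml opprD.
by rewrite [X in _ && X]lerD // andbT lerD // lerNl // opprK.
Qed.

Let dual_abs_le f x : 0 <= x -> (dual_join f (- f) x : R) <= `|f| * `|x|.
Proof.
move=> x0; rewrite /dual_join boundedOpD dual_posE // opprK boundedOpN.
rewrite -lerBrDl opprK; apply: cone_sup_le => // y y0 yx.
rewrite -lerBlDr boundedOpD -addrA -[f y - f x]linearB -[f y + _]linearD /=.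
rewrite (le_trans (ler_norm _)) // (le_trans (ler_boundedOp _ _)) //.
rewrite ler_wpM2l // norm_modulus_mono // (ger0_modulus x0) modulus_le.
have yN : - y <= 0 by rewrite -[0]oppr0 bl_lerN2.
apply/andP; split.
  rewrite -[leRHS]addr0 bl_lerD // -(bl_lerD2r x (y - x) 0).
  by rewrite subrK add0r.
rewrite opprD opprB -[leRHS]add0r bl_lerD // -[leRHS]addr0.
by rewrite bl_lerD2l.
Qed.

Let dual_norm_mono f g :
  dual_le (dual_join f (- f)) (dual_join g (- g)) -> `|f| <= `|g|.
Proof.
move=> /dual_leP fg; apply: boundedOp_norm_le => // x.
rewrite (le_trans (ler_dual_abs f x)) // (le_trans (fg _ (modulus_ge0 x))) //.
by rewrite -(norm_modulus x) dual_abs_le // modulus_ge0.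
Qed.

HB.instance Definition _ := CompleteNormedModule_isBanachLattice.Build R
  (boundedOp E R^o) dual_le_refl dual_le_anti dual_le_trans dual_le_meet
  dual_ge_join dual_leD2r dual_leZ_ge0 dual_norm_mono.

(* So that f <= g also elaborates for f, g : dual E. *)
HB.instance Definition _ := Order.Lattice.copy (boundedOp E R^o)
  (BanachLattice.sort (boundedOp E R^o : banachLatticeType R)).

Lemma dual_leE f g : (f <= g) = `[< forall x, 0 <= x -> (f x : R) <= g x >].
Proof. by []. Qed.

End dual_lattice.

Lemma dual_ge0P (R : realType) (E : banachLatticeType R) (f : dual E) :
  0 <= f <-> forall x : E, 0 <= x -> 0 <= (f x : R).
Proof. by rewrite dual_leE; split => /asboolP. Qed.

Section adjoint.
Context {R : realType} {V W : normedModType R}.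

Let adjointL (T : boundedOp V W) (phi : dual W) : linear (phi \o T : V -> R^o).
Proof. by move=> a x y /=; rewrite !linearP. Qed.
Let adjointC (T : boundedOp V W) (phi : dual W) : continuous (phi \o T : V -> R^o).
Proof. by move=> x; apply: continuous_comp; exact: boundedOp_continuous. Qed.

Definition adjoint_fun (T : boundedOp V W) (phi : dual W) : dual V :=
  BoundedOp (adjointL T phi) (@adjointC T phi).

Let adjoint_linear T : linear (adjoint_fun T).
Proof. by move=> a f g; apply/boundedOpP. Qed.

Let adjoint_continuous T : continuous (adjoint_fun T).
Proof.
apply: (@linear_bound_continuous _ _ _ _ `|T|) (adjoint_linear T) _ => phi.
apply: boundedOp_norm_le => [|x /=]; first by rewrite mulr_ge0.
rewrite (le_trans (ler_boundedOp _ _)) // mulrAC [leRHS]mulrC ler_wpM2l //.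
exact: ler_boundedOp.
Qed.

Definition adjoint (T : boundedOp V W) : boundedOp (dual W) (dual V) :=
  BoundedOp (adjoint_linear T) (@adjoint_continuous T).
End adjoint.

(* u belongs to l_p. *)
Definition in_ell (R : realType) (p : R) (u : R^nat) :=
  cvgn [series `|u n| `^ p]_n.

Definition weakly_p_summable (R : realType) (p : R) (Z : normedModType R)
    (x : Z^nat) :=
  forall phi : dual Z, in_ell p (fun n => phi (x n)).

Definition disjoint_seq (R : realType) (E : banachLatticeType R) (x : E^nat) :=
  forall n m, n != m -> modulus (x n) `&` modulus (x m) = 0.

Definition disjoint_p_convergent (R : realType) (p : R)
    (E : banachLatticeType R) (Y : normedModType R) (T : boundedOp E Y) :=
  forall x : E^nat, disjoint_seq x -> weakly_p_summable p x ->
    T (x n) @[n --> \oo] --> (0 : Y).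

Definition positive_op (R : realType) (E F : banachLatticeType R)
    (T : boundedOp E F) := forall x : E, 0 <= x -> 0 <= T x.

(* Y with the weak topology sigma(Y, Y^* ), i.e. the initial topology for the
   evaluation map of Y into the product of dual Y copies of R. *)
Definition weak (R : realType) (Y : normedModType R) : topologicalType :=
  initial_topology
    ((fun y phi => phi y) : Y -> prod_topology (fun _ : dual Y => R^o)).

Definition order_weakly_compact (R : realType) (E : banachLatticeType R)
    (Y : normedModType R) (T : boundedOp E Y) :=
  forall x : E, 0 <= x ->
    compact (closure (T @` [set y | 0 <= y <= x] : set (weak Y))).

(* Every net (x_i) decreasing to 0 is norm null; the index set I is a directed
   preorder. *)
Definition order_continuous_norm (R : realType) (E : banachLatticeType R) :=
  forall (I : Type) (le : I -> I -> Prop) (x : I -> E),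
    inhabited I -> (forall i, le i i) ->
    (forall i j k, le i j -> le j k -> le i k) ->
    (forall i j, exists k, le i k /\ le j k) ->
    (forall i j, le i j -> x j <= x i) -> infimums (range x) 0 ->
    forall e : R, 0 < e -> exists i, forall j, le i j -> `|x j| < e.

Definition positive_schur_property (R : realType) (p : R) (E : banachLatticeType R) :=
  forall x : E^nat, (forall n, 0 <= x n) -> weakly_p_summable p x ->
    x n @[n --> \oo] --> (0 : E).

(* Main.v *)
Require Import Defs.
From mathcomp Require Import all_boot all_order all_algebra.
From mathcomp Require Import all_classical all_reals all_analysis.
From mathcomp Require Import ring lra.

(** The theorem is proved by contraposition: if [E^*] does not have order
    continuous norm and [F^*] fails the positive Schur property of order [p],
    then a positive order weakly compact operator factoring through [ell_1] has
    an adjoint that is not disjoint [p]-convergent.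

    On the side of [E], a net decreasing to 0 whose norms do not tend to 0 is not
    norm Cauchy, so the differences along a suitable increasing sequence of
    indices are positive functionals [g n] whose partial sums stay below one
    functional [phi] and whose norms are bounded below
    ([not_order_continuous_norm]).  Hence [x |-> (g n x)_n] is a positive bounded
    operator from [E] to [ell_1].

    On the side of [F], there are positive weakly [p]-summable functionals [f n]
    that are large at vectors [y n] of the positive unit ball.  Since [f n] tends
    weakly to 0, a subsequence has [f n] very small at the earlier [y j], so the
    [y n] can be replaced by pairwise disjoint [z n <= y n] without losing more
    than a fraction of [f n (y n)] ([disjointify]).  The component [h n] of [f n]
    carried by [z n] has the same value as [f n] at [z n], and the [h n] are
    disjoint because the [z n] are ([carried_disjoint]); being dominated by the
    [f n], they are still weakly [p]-summable ([not_positive_schur]).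

    The operator is [T x = \sum_n (g n x) z n] ([ell1_op]).  It maps [[0, x]] into
    the set of all [\sum_n c n z n] with [0 <= c n <= g n x], a continuous image
    of a product of compact intervals, so [T] is order weakly compact.  If [x n]
    in the positive unit ball nearly norms [g n], then
    [T^* (h n) (x n) >= (g n (x n)) (h n (z n))] is bounded below, so the norms of
    the [T^* (h n)] do not tend to 0. *)

Set Implicit Arguments.
Unset Strict Implicit.
Unset Printing Implicit Defensive.

Import Order.TTheory GRing.Theory Num.Theory.
Import numFieldNormedType.Exports.

Local Open Scope classical_set_scope.
Local Open Scope order_scope.
Local Open Scope ring_scope.

(** * Norm and order limits *)

Section cone.
Context {R : realType} {L : banachLatticeType R}.
Implicit Types x y : L.

Lemma bl_sum_ge0 (I : Type) (r : seq I) (P : pred I) (u : I -> L) :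
  (forall i, P i -> 0 <= u i) -> 0 <= \sum_(i <- r | P i) u i.
Proof. by move=> u0; apply: (big_ind (fun z : L => 0 <= z)) => //; exact: bl_addr_ge0. Qed.

(** The negative part of [x] is dominated by [|c - x|] for every [c >= 0].  The
    statement by approximation serves both sequences and nets. *)
Lemma ge0_closed x :
  (forall e : R, 0 < e -> exists2 c : L, 0 <= c & `|c - x| < e) -> 0 <= x.
Proof.
move=> xc; suff npart0 : npart x = 0 by rewrite -(ppartB x) npart0 subr0 ppart_ge0.
apply/normr0_eq0/le_anti; rewrite normr_ge0 andbT.
apply/ler_addgt0Pr => e e0; rewrite add0r.
have [c c0 cx] := xc _ e0; apply: le_trans (ltW cx).
rewrite -(norm_modulus (c - x)) bl_norm_le ?npart_ge0 //.
set m := modulus _.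
have xm : - x <= m.
  rewrite (le_trans _ (ler_modulus (c - x))) //.
  by rewrite -[leLHS]add0r bl_lerD2r.
have m0 : 0 <= m by exact: modulus_ge0.
rewrite [leRHS]half_split bl_ler_wpZ // -(bl_lerD2r x) subrK modulus_le.
apply/andP; split; first by rewrite -[leLHS]add0r bl_lerD2r bl_addr_ge0.
by rewrite -(bl_lerD2r (- x)) addrK bl_lerD.
Qed.

(** If there were no such sequence, every net decreasing to 0 would be norm Cauchy,
    and the limit of a decreasing Cauchy net is its infimum. *)
Lemma not_order_continuous_norm : ~ order_continuous_norm L ->
  exists (g : nat -> L) (phi : L) (e : R),
    [/\ 0 < e, forall n, 0 <= g n, forall n, \sum_(i < n) g i <= phi
      & forall n, e <= `|g n|].
Proof.
apply: contra_notP => nog I le x I0 le_refl le_trans le_dir xle [x0 xinf].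
have xge0 i : 0 <= x i by apply: x0; exists i.
(* If the net were not Cauchy at scale [d], iterating a choice of a later index at
   distance at least [d] would give the forbidden sequence of differences. *)
have xC (d : R) : 0 < d -> exists i, forall j, le i j -> `|x i - x j| < d.
  move=> d0; apply: contrapT => /forallNP noi; apply: nog.
  have nexti i : exists j, le i j /\ d <= `|x i - x j|.
    have /existsNP[j /not_implyP[ij /negP]] := noi i.
    by rewrite -leNgt => ?; exists j.
  have [next nextP] := choice nexti; case: I0 => i0.
  pose i_ n := iter n next i0.
  exists (fun n => x (i_ n) - x (i_ n.+1)), (x i0), d; split => // [n|n|n].
  - by rewrite bl_subr_ge0 xle //; have [] := nextP (i_ n).
  - rewrite -(big_mkord xpredT (fun i => x (i_ i) - x (i_ i.+1))).
    under eq_bigr do rewrite -opprB.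
    rewrite sumrN telescope_sumr // opprB -bl_subr_ge0 opprB addrC subrK.
    exact: xge0.
  - by have [] := nextP (i_ n).
pose tails i := [set x j | j in [set j | le i j]].
pose F : set_system L := filter_from [set: I] tails.
have FF : ProperFilter F.
  apply: filter_from_proper; last by move=> i _; exists (x i), i.
  apply: filter_from_filter; first by case: I0 => i; exists i.
  move=> i j _ _; have [k [ik jk]] := le_dir i j.
  by exists k => // _ [l /= kl <-]; split; exists l => //=;
    [exact: le_trans kl|exact: le_trans kl].
have Fx : cvg F.
  apply: cauchy_cvg; apply: cauchy_exP => d d0; have [i xi] := xC d d0.
  by exists (x i); exists i => // _ [j /= ij <-]; rewrite -ball_normE /= xi.
pose y := lim F.
have xy (d : R) : 0 < d -> exists i, forall j, le i j -> `|x j - y| < d.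
  move=> d0; have [i _ iy] : F (ball y d) by apply: (Fx : F --> y); exact: nbhsx_ballx.
  exists i => j ij; rewrite distrC.
  by have := iy (x j); rewrite -ball_normE; apply; exists j.
have y0 : y = 0.
  apply/le_anti/andP; split; last first.
    by apply: ge0_closed => d /xy[i]/(_ i (le_refl i)) ?; exists (x i).
  apply: xinf => _ [i _ <-]; rewrite -bl_subr_ge0; apply: ge0_closed => d /xy[j xj].
  have [k [ik jk]] := le_dir i j.
  exists (x i - x k); first by rewrite bl_subr_ge0 xle.
  by rewrite opprB addrC addrA subrK distrC xj.
by move=> e /xy[i xi]; exists i => j /xi; rewrite y0 subr0.
Qed.
End cone.

(** * Positive functionals and their components *)

Section functionals.
Context {R : realType} {E : banachLatticeType R}.
Implicit Types (f g : dual E) (x y z : E).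

Lemma dual_mono g x y : 0 <= g -> x <= y -> (g x : R) <= g y.
Proof.
move=> /dual_ge0P g0 xy; rewrite -subr_ge0.
by have := g0 (y - x); rewrite bl_subr_ge0 linearB => /(_ xy).
Qed.

Lemma ler_dual_modulus g x : 0 <= g -> `|g x : R| <= g (modulus x).
Proof.
move=> g0; rewrite ler_norml dual_mono ?ler_modulus // andbT.
have := dual_mono g0 (lerN_modulus x); rewrite linearN => h.
by rewrite lerNl.
Qed.

(** A positive functional nearly attains its norm on the positive part of the
    unit ball, since [x] can be replaced by its modulus. *)
Lemma dual_ge0_norming g (e : R) : 0 < e -> 0 <= g -> e <= `|g| ->
  exists x, [/\ 0 <= x, `|x| <= 1 & e / 2 <= (g x : R)].
Proof.
move=> e0 g0 eg; apply: contrapT => /forallNP nox.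
have e2 : 0 < e / 2 by rewrite divr_gt0.
suff : `|g| <= e / 2 by move: eg e0; lra.
apply: boundedOp_norm_le => [|x]; first exact: ltW.
have [->|x0] := eqVneq x 0; first by rewrite linear0 !normr0 mulr0.
have nx : 0 < `|x| by rewrite normr_gt0.
apply: (le_trans (ler_dual_modulus x g0)).
rewrite -ler_pdivrMr // mulrC leNgt; apply/negP => gx.
apply: (nox (`|x|^-1 *: modulus x)).
split; last by rewrite linearZ ltW.
  by rewrite bl_scaler_ge0 ?invr_ge0 // modulus_ge0.
by rewrite normrZ norm_modulus normfV normr_id mulVf // gt_eqF.
Qed.

(** The functional is [q x^+ - q x^-]; additivity of [q] makes [q a - q b]
    depend only on [a - b]. *)
Lemma dual_extend (q : E -> R) f :
  (forall x y, 0 <= x -> 0 <= y -> q (x + y) = q x + q y) ->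
  (forall (a : R) x, 0 < a -> 0 <= x -> q (a *: x) = a * q x) ->
  (forall x, 0 <= x -> 0 <= q x <= f x) ->
  exists h : dual E, forall x, 0 <= x -> h x = q x.
Proof.
move=> qD qZ qf.
have q0 : q 0 = 0 by apply: (addrI (q 0)); rewrite -qD // !addr0.
pose h x : R := q (ppart x) - q (npart x).
have hB a b : 0 <= a -> 0 <= b -> h (a - b) = q a - q b.
  move=> a0 b0; rewrite /h; set x := a - b.
  have : q (ppart x) + q b = q a + q (npart x).
    rewrite -!qD ?ppart_ge0 ?npart_ge0 //; congr q.
    by rewrite -[ppart x](subrK (npart x)) ppartB /x addrAC subrK.
  lra.
have hD x y : h (x + y) = h x + h y.
  rewrite -{1}(ppartB x) -{1}(ppartB y) addrACA -opprD.
  rewrite hB ?bl_addr_ge0 ?ppart_ge0 ?npart_ge0 //.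
  by rewrite !qD ?ppart_ge0 ?npart_ge0 // /h; lra.
have hN x : h (- x) = - h x.
  by rewrite -{1}(ppartB x) opprB hB ?ppart_ge0 ?npart_ge0 // /h opprB.
have hZ (a : R) x : 0 < a -> h (a *: x) = a * h x.
  move=> a0; rewrite -{1}(ppartB x) scalerBr.
  have a0' := ltW a0; rewrite hB ?(bl_scaler_ge0 a0') ?ppart_ge0 ?npart_ge0 //.
  by rewrite !(qZ a) ?ppart_ge0 ?npart_ge0 // -mulrBr.
have hl : linear (h : E -> R^o).
  move=> a x y; rewrite hD; congr (_ + _).
  have [a0|a0|<-] := ltrgtP 0 a; first exact: hZ.
    by rewrite -[a]opprK scaleNr hN hZ ?oppr_gt0 // -mulNr.
  rewrite !scale0r; have := hB 0 0; rewrite subr0 q0 subrr; exact.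
have hb x : `|h x : R^o| <= `|f| * `|x|.
  have /andP[u0 u1] := qf _ (ppart_ge0 x); have /andP[v0 v1] := qf _ (npart_ge0 x).
  rewrite -(norm_modulus x); apply: le_trans (ler_boundedOp _ _).
  apply: le_trans (ler_norm _); rewrite -ppartD linearD /h ler_norml.
  by apply/andP; split; lra.
exists (BoundedOp hl (linear_bound_continuous hl hb)) => x x0 /=.
by rewrite -[x in LHS]subr0 hB // q0 subr0.
Qed.

(** For [x >= 0] this is the supremum over [m] of [f (x /\ m z)], the value at [x]
    of the component of [f] in the band of functionals carried by [z].  Ranging
    over all [b <= x] in the ideal generated by [z] makes additivity in [x] a
    direct consequence of the Riesz decomposition. *)
Definition carried f z x : R :=
  sup [set (f b : R) | b in
    [set b | 0 <= b <= x /\ exists2 m : R, 0 <= m & b <= m *: z]].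

Section carried.
Variables (f : dual E) (z : E).
Hypothesis f0 : 0 <= f.

Let carried_has_sup x : 0 <= x ->
  has_sup [set (f b : R) | b in
    [set b | 0 <= b <= x /\ exists2 m : R, 0 <= m & b <= m *: z]].
Proof.
move=> x0; split.
  by exists (f 0), 0 => //=; split; [rewrite lexx x0|exists 0; rewrite ?scale0r].
by exists (f x) => _ [b /= [/andP[_ bx] _] <-]; exact: dual_mono.
Qed.

Lemma le_carried x b (m : R) : 0 <= b -> b <= x -> 0 <= m -> b <= m *: z ->
  (f b : R) <= carried f z x.
Proof.
move=> b0 bx m0 bz; apply: sup_upper_bound; first exact/carried_has_sup/(le_trans b0).
by exists b => //=; split; [rewrite b0|exists m].
Qed.

Lemma carried_le x (M : R) : 0 <= x ->
  (forall b (m : R), 0 <= b -> b <= x -> 0 <= m -> b <= m *: z -> (f b : R) <= M) ->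
  carried f z x <= M.
Proof.
move=> x0 fM; apply: ge_sup; first by have [] := carried_has_sup x0.
by move=> _ [b /= [/andP[b0 bx] [m m0 bz]] <-]; exact: fM bz.
Qed.

Lemma carried_bounds x : 0 <= x -> 0 <= carried f z x <= f x.
Proof.
move=> x0; apply/andP; split.
  by rewrite -[leLHS](linear0 f) (@le_carried _ _ 0) // scale0r.
by apply: carried_le => // b m _ bx _ _; exact: dual_mono.
Qed.

Lemma carriedD x y : 0 <= x -> 0 <= y ->
  carried f z (x + y) = carried f z x + carried f z y.
Proof.
move=> x0 y0; apply/le_anti/andP; split.
  apply: carried_le => [|b m b0 bxy m0 bz]; first exact: bl_addr_ge0.
  have [c [d [c0 cx d0 dy e]]] := riesz_decomposition x0 y0 b0 bxy.
  rewrite e linearD lerD //.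
    apply: le_carried m0 _ => //; apply: le_trans bz.
    by rewrite e -[leLHS]addr0 bl_lerD2l.
  apply: le_carried m0 _ => //; apply: le_trans bz.
  by rewrite e -[leLHS]add0r bl_lerD2r.
rewrite -lerBrDr; apply: carried_le => // b m b0 bx m0 bz.
rewrite lerBrDl -lerBrDr; apply: carried_le => // c n c0 cy n0 cz.
rewrite lerBrDr addrC -(linearD f) (@le_carried _ _ (m + n)) ?addr_ge0 ?bl_addr_ge0 //.
  exact: bl_lerD.
by rewrite scalerDl bl_lerD.
Qed.

Lemma carriedZ (a : R) x : 0 < a -> 0 <= x ->
  carried f z (a *: x) = a * carried f z x.
Proof.
have le (c : R) y : 0 < c -> 0 <= y -> carried f z (c *: y) <= c * carried f z y.
  move=> c0 y0; apply: carried_le => [|b m b0 by_ m0 bz].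
    by rewrite bl_scaler_ge0 // ltW.
  have c'0 : 0 <= c^-1 by rewrite invr_ge0 ltW.
  rewrite -ler_pdivrMl // [leLHS](_ : _ = f (c^-1 *: b)); last by rewrite linearZ.
  apply: (@le_carried _ _ (c^-1 * m)); rewrite ?mulr_ge0 ?bl_scaler_ge0 //.
    by rewrite -[leRHS]scale1r -(@mulVf _ c) ?gt_eqF // -scalerA bl_ler_wpZ.
  by rewrite -scalerA bl_ler_wpZ.
move=> a0 x0; apply/le_anti; rewrite le //= -ler_pdivlMl //.
have ax0 : 0 <= a *: x by rewrite bl_scaler_ge0 // ltW.
have ai : 0 < a^-1 by rewrite invr_gt0.
by have := le _ _ ai ax0; rewrite scalerA mulVf ?gt_eqF // scale1r.
Qed.

End carried.

Lemma carried_functional f z : 0 <= f ->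
  exists h : dual E, forall x, 0 <= x -> h x = carried f z x.
Proof.
move=> f0; apply: (dual_extend (f := f)) => *.
- exact: carriedD.
- exact: carriedZ.
- exact: carried_bounds.
Qed.


Lemma modulus_disjoint (L : banachLatticeType R) (a b : L) : 0 <= a -> 0 <= b ->
  (forall d, 0 <= d -> d <= a -> d <= b -> d <= 0) -> modulus a `&` modulus b = 0.
Proof.
move=> a0 b0 ab; rewrite !ger0_modulus //; apply/le_anti/andP; split.
  by apply: ab; rewrite ?leIl ?leIr // lexI a0 b0.
by rewrite lexI a0 b0.
Qed.

(** A common minorant [d] of [h] and [k] is small at [x]: most of [h x] comes
    from some [b <= x] in the ideal of [z], so [d (x - b)] is small, while [k]
    vanishes at [b] because [b] is disjoint from [z']. *)
Lemma carried_disjoint f f' z z' (h k : dual E) :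
  0 <= f -> 0 <= f' -> 0 <= z -> 0 <= z' -> z `&` z' = 0 ->
  (forall x, 0 <= x -> h x = carried f z x) ->
  (forall x, 0 <= x -> k x = carried f' z' x) ->
  modulus (h : dual E) `&` modulus (k : dual E) = 0.
Proof.
move=> f0 f'0 z0 z'0 zz' hE kE.
have h0 : 0 <= h.
  by apply/dual_ge0P => x x0; rewrite hE //; have /andP[] := carried_bounds z f0 x0.
have k0 : 0 <= k.
  by apply/dual_ge0P => x x0; rewrite kE //; have /andP[] := carried_bounds z' f'0 x0.
apply: modulus_disjoint => // d d0.
rewrite !dual_leE => /asboolP dh /asboolP dk; apply/asboolP => x x0.
rewrite -[leRHS](subrr (h x)) lerBrDl -lerBrDr {1}hE //.
apply: carried_le => // b m b0 bx m0 bz; rewrite lerBrDr.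
have kb : k b = 0.
  apply/le_anti; have /dual_ge0P -> // := k0; rewrite andbT kE //.
  apply: carried_le => // c n c0 cb n0 cz'.
  suff -> : c = 0 by rewrite linear0.
  have mn : 0 <= Num.max m n by rewrite le_max m0.
  have mz (l : R) (y : E) : 0 <= y -> l <= Num.max m n -> l *: y <= Num.max m n *: y.
    by move=> y0 lm; rewrite -bl_subr_ge0 -scalerBl bl_scaler_ge0 // subr_ge0.
  have cz1 : c <= Num.max m n *: z.
    by rewrite (le_trans cb) // (le_trans bz) // mz // le_max lexx.
  have cz2 : c <= Num.max m n *: z'.
    by rewrite (le_trans cz') // mz // le_max lexx orbT.
  have [e|M0] := eqVneq (Num.max m n) 0.
    by apply/le_anti; rewrite c0 andbT; rewrite e scale0r in cz1.
  have Mi : 0 <= (Num.max m n)^-1 by rewrite invr_ge0.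
  have : (Num.max m n)^-1 *: c <= z `&` z'.
    rewrite lexI -[z](scalerK M0) -[z'](scalerK M0).
    by rewrite !(bl_ler_wpZ Mi).
  rewrite zz' => /(bl_ler_wpZ mn); rewrite scalerA mulfV // scale1r scaler0 => cle.
  by apply/le_anti; rewrite c0 cle.
have db : (d b : R) <= 0 by rewrite -kb; exact: dk.
have dxb : (d (x - b) : R) <= h (x - b) by apply: dh; rewrite bl_subr_ge0.
have fb : (f b : R) <= h b by rewrite hE //; exact: le_carried bz.
by move: dxb; rewrite !linearB /=; lra.
Qed.

End functionals.

(** * Disjointification *)

Section disjointification.
Context {R : realType} {E : banachLatticeType R}.
Implicit Types (u : nat -> E) (v Y : E).

Lemma join0_oppE v : (- v) `|` 0 = (v `|` 0 : E) - v.
Proof.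
apply/le_anti/andP; split.
  by rewrite leUx bl_subr_ge0 leUl andbT -[leLHS]add0r bl_lerD2r leUr.
rewrite -(bl_lerD2r v) subrK leUx -{1}[v]add0r bl_lerD2r leUr /=.
by rewrite -(bl_lerD2r (- v)) addrK add0r leUl.
Qed.

(** The positive parts of [v] and [- v] are disjoint: as the second one is
    [v^+ - v], subtracting a common minorant [d] from [v^+] leaves a majorant of
    [v] and 0, hence of [v^+]. *)
Lemma join0_disjoint v d : d <= v `|` 0 -> d <= (- v) `|` 0 -> d <= 0.
Proof.
rewrite join0_oppE => dv dv'.
have h : v `|` 0 <= (v `|` 0 : E) - d.
  rewrite leUx bl_subr_ge0 dv andbT -(bl_lerD2r d) subrK -(bl_lerD2r (- v)).
  by rewrite addrAC subrr add0r.
by rewrite -(bl_lerD2r ((v `|` 0 : E) - d)) add0r addrC subrK.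
Qed.

Lemma scale_join0 (a : R) v : 0 <= a -> a <= 1 -> a *: (v `|` 0 : E) <= v `|` 0.
Proof.
move=> a0 a1; rewrite -bl_subr_ge0 -{1}[v `|` 0]scale1r -scalerBl.
by rewrite bl_scaler_ge0 ?subr_ge0 // leUr.
Qed.

(** [4^n] times the sum removes from [u n] what it shares with the earlier terms,
    and [2^-n Y], for [Y] dominating all [2^-m u m], what it shares with the
    later ones. *)
Definition disjointify u Y n : E :=
  (u n - 4 ^+ n *: \sum_(i < n) u i - 2 ^- n *: Y) `|` 0.

Lemma disjointify_ge0 u Y n : 0 <= disjointify u Y n.
Proof. exact: leUr. Qed.

Lemma disjointify_le u Y n : (forall n, 0 <= u n) -> 0 <= Y ->
  disjointify u Y n <= u n.
Proof.
move=> u0 Y0; rewrite leUx u0 andbT -addrA -[leRHS]addr0 bl_lerD2l -opprD.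
rewrite -[leRHS]oppr0 bl_lerN2.
rewrite bl_addr_ge0 // bl_scaler_ge0 ?invr_ge0 ?exprn_ge0 //.
exact: bl_sum_ge0.
Qed.

(** For [n < m], with [v = u m - 4^m u n], the [m]-th term is below [v^+] because
    [u n] occurs in the sum, and the [n]-th one below [4^-m v^-] because
    [2^-m u m <= Y]. *)
Lemma disjointify_disjoint u Y n m :
  (forall n, 0 <= u n) -> (forall n, 2 ^- n *: u n <= Y) -> n != m ->
  disjointify u Y n `&` disjointify u Y m = 0.
Proof.
move=> u0 uY; wlog nm : n m / (n < m)%N => [hw|_].
  rewrite neq_ltn => /orP[nm|mn]; first by rewrite hw // neq_ltn nm.
  by rewrite meetC hw // neq_ltn mn.
have Y0 : 0 <= Y by rewrite (le_trans _ (uY 0)) // expr0 invr1 scale1r.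
have p0 (b : R) k : 0 <= b -> 0 <= b ^- k by move=> ?; rewrite invr_ge0 exprn_ge0.
set v := u m - 4 ^+ m *: u n.
have zm : disjointify u Y m <= v `|` 0.
  rewrite leU2 // -[leRHS]addr0 bl_lerD //; last first.
    by rewrite -[leRHS]oppr0 bl_lerN2 bl_scaler_ge0 // p0.
  rewrite bl_lerD2l bl_lerN2 bl_ler_wpZ ?exprn_ge0 //.
  rewrite (bigD1 (Ordinal nm)) //= -[leLHS]addr0 bl_lerD2l.
  exact: bl_sum_ge0.
have zn : disjointify u Y n <= (- v) `|` 0.
  have c0 : (0 : R) <= 4 ^- m by rewrite p0.
  apply: (@le_trans _ _ (4 ^- m *: ((- v) `|` 0 : E))); last first.
    by rewrite scale_join0 // invf_le1 ?exprn_gt0 // exprn_ege1 // ler1n.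
  rewrite leUx bl_scaler_ge0 ?leUr // andbT.
  apply: le_trans (bl_ler_wpZ c0 (leUl _ _)).
  rewrite opprB scalerBr scalerA mulVf ?expf_neq0 // scale1r.
  rewrite addrAC -[leRHS]addr0 bl_lerD //; last first.
    by rewrite -[leRHS]oppr0 bl_lerN2 bl_scaler_ge0 ?exprn_ge0 //; exact: bl_sum_ge0.
  rewrite bl_lerD2l bl_lerN2 (_ : 4 ^- m = 2 ^- m * 2 ^- m); last first.
    by rewrite -invfM -exprMn -natrM.
  rewrite -scalerA (le_trans (bl_ler_wpZ (p0 2 m _) (uY m))) //.
  rewrite -bl_subr_ge0 -scalerBl bl_scaler_ge0 // subr_ge0.
  by rewrite lef_pV2 ?posrE ?exprn_gt0 // ler_eXn2l ?ltr1n // ltnW.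
apply/le_anti; rewrite lexI !leUr !andbT.
apply: (@join0_disjoint v); first exact: le_trans (leIr _ _) zm.
exact: le_trans (leIl _ _) zn.
Qed.
End disjointification.

(** * Series with dominated coefficients *)

Section dominated_series.
Context {R : realType} {Y : completeNormedModType R}.
Variable w : nat -> Y.
Hypothesis w1 : forall k, `|w k| <= 1.
Implicit Types (c d : nat -> R).

Definition wsum c : Y := limn (series (fun k => c k *: w k)).

Lemma wsum_cvg c d : (forall k, `|c k| <= d k) -> cvgn (series d) ->
  series (fun k => c k *: w k) @ \oo --> wsum c.
Proof.
move=> cd dcvg; apply: normed_cvg; apply: series_le_cvg dcvg => k //=.
  exact: le_trans (cd k).
by rewrite normrZ (le_trans _ (cd k)) // ler_piMr.
Qed.

Lemma wsum_tail c d N : (forall k, `|c k| <= d k) -> cvgn (series d) ->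
  `|wsum c - series (fun k => c k *: w k) N| <= limn (series d) - series d N.
Proof.
move=> cd dcvg; have d0 k : 0 <= d k by exact: le_trans (cd k).
have /cvg_norm h : (series (fun k => c k *: w k) n - series (fun k => c k *: w k) N)
    @[n --> \oo] --> wsum c - series (fun k => c k *: w k) N.
  by apply: cvgB; [exact: wsum_cvg dcvg|exact: cvg_cst].
apply: (cvgr_to_le h); exists N => // n /= Nn.
rewrite sub_series_geq // (le_trans (ler_norm_sum _ _ _)) //.
rewrite (@le_trans _ _ (\sum_(N <= k < n) d k)) //.
  by apply: ler_sum => k _; rewrite normrZ (le_trans _ (cd k)) // ler_piMr.
rewrite -sub_series_geq // lerD2r nondecreasing_cvgn_le //.
exact: (nondecreasing_series (P := xpredT) (m := 0)).
Qed.

(** Truncating the coefficients at 0 and [d k] turns the sum into a function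
    defined on the whole product space. *)
Definition trunc d (c : prod_topology (fun _ : nat => R^o)) k : R :=
  Num.min (Num.max (c k) 0) (d k).

Lemma trunc_bound d c k : (forall k, 0 <= d k) -> `|trunc d c k| <= d k.
Proof.
move=> d0; rewrite ger0_norm ?ge_min ?lexx ?orbT //.
by rewrite le_min d0 le_max lexx orbT.
Qed.

Lemma trunc_id d (c : prod_topology (fun _ : nat => R^o)) :
  (forall k, 0 <= c k <= d k) -> trunc d c = c.
Proof.
move=> cd; apply/funext => k; have /andP[c0 ck] := cd k.
by rewrite /trunc max_l // min_l.
Qed.

(** The tails of the series are bounded by those of [series d], uniformly in [c],
    and each partial sum depends continuously on finitely many coordinates. *)
Lemma wsum_trunc_continuous d : (forall k, 0 <= d k) -> cvgn (series d) ->
  continuous (fun c : prod_topology (fun _ : nat => R^o) => wsum (trunc d c)).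
Proof.
move=> d0 dcvg; set f := (f in continuous f) => c.
apply/(@cvgrPdist_le _ _ _ (nbhs c) _ f (f c)) => e e0; rewrite /f {f}.
have e3 : 0 < e / 3 by rewrite divr_gt0.
have [N _ dN] : \forall n \near \oo, `|limn (series d) - series d n| <= e / 3.
  by have /cvgrPdist_le/(_ _ e3) := dcvg.
have tail c' : `|wsum (trunc d c') - series (fun k => trunc d c' k *: w k) N| <= e / 3.
  apply: le_trans (dN N _) => //=; apply: le_trans (ler_norm _).
  by apply: wsum_tail => // k; exact: trunc_bound.
have tc k : continuous (fun c' : prod_topology (fun _ : nat => R^o) =>
    trunc d c' k : R^o).
  set P := prod_topology _ => x.
  have pc : {for x, continuous (fun c' : P => c' k : R^o)}.
    exact: (@proj_continuous nat (fun _ => R^o) k).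
  have cc (r : R) : {for x, continuous (fun _ : P => r : R^o)} by exact: cst_continuous.
  exact: (continuous_min (continuous_max pc (cc 0)) (cc (d k))).
have cont : continuous (fun c' : prod_topology (fun _ : nat => R^o) =>
    series (fun k => trunc d c' k *: w k) N).
  apply: continuous_big => [|k _ x]; first exact: add_continuous.
  have h := @tc k x; exact: (cvgZr_tmp (a := w k) h).
have /(@cvgrPdist_le _ _ _ (nbhs c))/(_ _ e3) := cont c; apply: filterS => c' cc'.
have -> : e = e / 3 + (e / 3 + e / 3) by lra.
apply: le_trans (ler_distD (series (fun k => trunc d c k *: w k) N) _ _) _.
rewrite lerD // (le_trans (ler_distD (series (fun k => trunc d c' k *: w k) N) _ _)) //.
by rewrite lerD // distrC.
Qed.

(** By continuity, from the compactness of the product of the intervals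
    [[0, d k]]. *)
Lemma wsum_box_compact d : (forall k, 0 <= d k) -> cvgn (series d) ->
  compact [set wsum c | c in [set c | forall k, 0 <= c k <= d k]].
Proof.
move=> d0 dcvg.
have box : compact [set c : prod_topology (fun _ : nat => R^o) |
    forall k, `[0, d k]%classic (c k)].
  by apply: (@tychonoff nat (fun _ => R^o) (fun k => `[0, d k]%classic)) => k; exact: segment_compact.
suff -> : [set wsum c | c in [set c | forall k, 0 <= c k <= d k]] =
    (fun c => wsum (trunc d c)) @` [set c | forall k, `[0, d k]%classic (c k)].
  apply: continuous_compact box; apply: continuous_subspaceT.
  exact: wsum_trunc_continuous.
apply/seteqP; split=> _ [c /= cd <-].
  by exists c => [k|]; [rewrite /= in_itv /=|rewrite trunc_id].
have cd' k : 0 <= c k <= d k by have := cd k; rewrite /= in_itv /=.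
by exists c => //=; rewrite trunc_id.
Qed.
End dominated_series.

Lemma wsum_ge (R : realType) (F : banachLatticeType R) (w : nat -> F)
    (c : nat -> R) k :
  (forall k, 0 <= w k) -> (forall k, `|w k| <= 1) -> (forall k, 0 <= c k) ->
  cvgn (series c) -> c k *: w k <= wsum w c.
Proof.
move=> w0 w1 c0 ccvg; rewrite -bl_subr_ge0; apply: ge0_closed => e e0.
have cc j : `|c j| <= c j by rewrite ger0_norm.
have /cvgrPdist_lt/(_ _ e0)[N _ Ne] := wsum_cvg w1 cc ccvg.
pose M := maxn N k.+1; exists (series (fun k => c k *: w k) M - c k *: w k).
  have kM : (k < M)%N by rewrite leq_maxr.
  rewrite bl_subr_ge0 /series /= big_mkord (bigD1 (Ordinal kM)) //=.
  rewrite -[leLHS]addr0 bl_lerD2l; apply: bl_sum_ge0 => i _.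
  exact: bl_scaler_ge0.
by rewrite opprB addrA subrK distrC; apply: Ne; rewrite /= leq_maxl.
Qed.

(** * Operators through ell_1 *)

(** The evaluation map into the Hausdorff product of copies of [R] sends [K] to a
    closed compact set, whose preimage is weakly closed, contains [A], and is
    weakly compact because the weak topology is initial for that map. *)
Lemma weak_closure_compact (R : realType) (Y : normedModType R) (K A : set Y) :
  compact K -> A `<=` K -> compact (closure (A : set (weak Y))).
Proof.
move=> Kco AK.
pose ev (y : Y) : prod_topology (fun _ : dual Y => R^o) := fun phi => phi y.
have evc : continuous ev.
  move=> y; apply/(@pointwise_cvgP (dual Y) R^o) => phi.
  exact: boundedOp_continuous.
have Lco : compact (ev @` K).
  by apply: continuous_compact Kco; exact: continuous_subspaceT.
have Lcl : closed (ev @` K).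
  apply: compact_closed Lco; apply: hausdorff_product => _; exact: Rhausdorff.
have clK : closed (ev @^-1` (ev @` K) : set (weak Y)).
  by have /continuous_closedP := @initial_continuous Y _ ev; apply.
apply: (@subclosed_compact _ _ (ev @^-1` (ev @` K) : set (weak Y))).
- exact: closed_closure.
- move=> G GP GK.
  have [_ [[k Kk <-] kcl]] := Lco (ev @ G) _ GK.
  exists k; split; first by exists k.
  move=> U V GU [W [[B Bop <-] Bk BV]].
  have GevU : (ev @ G) (ev @` U) by apply: (@filterS _ G _ U) GU => x Ux; exists x.
  have [_ [[x Ux <-] Bx]] := kcl _ _ GevU (open_nbhs_nbhs (conj Bop Bk)).
  by exists x; split => //; exact: BV.
- rewrite ((closure_id _).1 clK); apply: closureS => y /AK Ky.
  by exists y.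
Qed.

Section ell1_operator.
Context {R : realType} {E F : banachLatticeType R}.
Variables (g : nat -> dual E) (phi : dual E) (w : nat -> F).
Hypotheses (g0 : forall k, 0 <= g k) (gphi : forall n, \sum_(k < n) g k <= phi).
Hypotheses (w0 : forall k, 0 <= w k) (w1 : forall k, `|w k| <= 1).

Lemma boundedOp_sumE (V W : normedModType R) (h : nat -> boundedOp V W) n x :
  (\sum_(k < n) h k) x = \sum_(k < n) h k x.
Proof. by elim: n => [|n IH]; rewrite ?big_ord0 // !big_ord_recr -IH. Qed.

Let gx_ge0 (x : E) k : 0 <= x -> 0 <= (g k x : R).
Proof. by move=> x0; have /dual_ge0P -> := g0 k. Qed.

Let gx_sum (x : E) n : 0 <= x -> series (fun k => g k x : R) n <= (phi x : R).
Proof.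
move=> x0; rewrite /series /= big_mkord -boundedOp_sumE.
by have := gphi n; rewrite dual_leE => /asboolP; exact.
Qed.

Lemma dominated_dual_cvg x : 0 <= x -> cvgn (series (fun k => g k x : R)).
Proof.
move=> x0; apply: nondecreasing_is_cvgn.
  by apply: (nondecreasing_series (P := xpredT) (m := 0)) => *; exact: gx_ge0.
by exists (phi x) => _ [n _ <-]; exact: gx_sum.
Qed.

Let gx_abs (x : E) k : `|g k x : R| <= g k (modulus x).
Proof. exact: ler_dual_modulus. Qed.

Let Tcvg x := wsum_cvg w1 (gx_abs x) (dominated_dual_cvg (modulus_ge0 x)).

Let T_linear : linear (fun x : E => wsum w (fun k => g k x : R)).
Proof.
move=> a x y; apply: cvg_lim => //=.
rewrite [X in X @ _](_ : _ = a \*: series (fun k => (g k x : R) *: w k) +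
    series (fun k => (g k y : R) *: w k)).
  exact: (cvgD (cvgZl_tmp (k := a) (@Tcvg x)) (@Tcvg y)).
apply/funext => n /=; rewrite /GRing.add /= /series /= scaler_sumr -big_split /=.
by apply: eq_bigr => k _; rewrite linearP scalerDl scalerA.
Qed.

Let T_bound (x : E) : `|wsum w (fun k => g k x : R)| <= `|phi| * `|x|.
Proof.
have := wsum_tail w1 0 (gx_abs x) (dominated_dual_cvg (modulus_ge0 x)).
rewrite /series /= !big_geq // !subr0 => /le_trans; apply.
rewrite -(norm_modulus x) (le_trans _ (ler_boundedOp _ _)) //.
rewrite (le_trans _ (ler_norm _)) //; apply: limr_le.
  exact: dominated_dual_cvg (modulus_ge0 x).
by apply: nearW => n; exact: gx_sum (modulus_ge0 x).
Qed.

(** The composition of [x |-> (g k x)_k], from [E] to [ell_1], with the operator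
    sending the unit vectors of [ell_1] to the [w k]. *)
Definition ell1_op : boundedOp E F :=
  BoundedOp T_linear (linear_bound_continuous T_linear T_bound).

Lemma ell1_op_ge x k : 0 <= x -> (g k x : R) *: w k <= ell1_op x.
Proof.
move=> x0; apply: (wsum_ge (c := fun k => g k x)) => // [j|]; first exact: gx_ge0.
exact: dominated_dual_cvg.
Qed.

Lemma ell1_op_positive : positive_op ell1_op.
Proof.
move=> x x0; apply: le_trans (ell1_op_ge 0 x0).
exact: bl_scaler_ge0 (gx_ge0 _ _) _.
Qed.

(** The coefficients of [ell1_op y], for [0 <= y <= x], lie between [0] and the
    summable sequence [g k x]. *)
Lemma ell1_op_order_weakly_compact : order_weakly_compact ell1_op.
Proof.
move=> x x0; apply: weak_closure_compact.
  apply: (wsum_box_compact w1 (d := fun k => g k x)) => [k|].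
    exact: gx_ge0.
  exact: dominated_dual_cvg.
move=> _ [y /= /andP[y0 yx] <-]; exists (fun k => g k y) => //= k.
by rewrite gx_ge0 // dual_mono.
Qed.
End ell1_operator.

(** * Weakly summable sequences of functionals *)

Section summable.
Context {R : realType} (p : R).
Hypothesis p1 : 1 <= p.

Lemma in_ell_cvg0 (u : R^nat) : in_ell p u -> u n @[n --> \oo] --> (0 : R^o).
Proof.
move=> /cvg_series_cvg_0 up; apply/cvgr0Pnorm_lt => e e0.
have ep : 0 < e `^ p by rewrite powR_gt0.
have /cvgr0Pnorm_lt/(_ _ ep) := up; apply: filterS => n.
rewrite ger0_norm ?powR_ge0 // => h; rewrite ltNge; apply: contraTN h => en.
by rewrite -leNgt ge0_ler_powR ?nnegrE ?normr_ge0 ?(le_trans _ p1) // ltW.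
Qed.

Lemma in_ell_le (u v : R^nat) : (forall n, `|u n| <= `|v n|) ->
  in_ell p v -> in_ell p u.
Proof.
move=> uv; apply: series_le_cvg => n; rewrite ?powR_ge0 //.
by rewrite ge0_ler_powR ?nnegrE ?normr_ge0 ?(le_trans _ p1).
Qed.

Lemma in_ell_subseq (u : R^nat) (s : nat -> nat) : {homo s : m n / (m < n)%N} ->
  in_ell p u -> in_ell p (u \o s).
Proof.
move=> smono uc; set v := fun n => `|u n| `^ p.
have v0 n : 0 <= v n by exact: powR_ge0.
have nd (v' : R^nat) : (forall n, 0 <= v' n) -> nondecreasing_seq (series v').
  by move=> v'0; apply: (nondecreasing_series (P := xpredT) (m := 0)).
have sub n : series (v \o s) n <= series v (s n).
  elim: n => [|n IH]; first by rewrite /series /= big_geq // sumr_ge0.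
  rewrite /series /= big_nat_recr //= (le_trans (lerD IH (lexx _))) //.
  rewrite (le_trans _ (nd v v0 _ _ (smono _ _ (ltnSn n)))) //.
  by rewrite /series /= big_nat_recr.
apply: nondecreasing_is_cvgn; first by apply: (nd (v \o s)) => n; exact: v0.
exists (limn (series v)) => _ [n _ <-]; apply: (le_trans (sub n)).
exact: nondecreasing_cvgn_le (nd v v0) uc _.
Qed.

(** A functional [Phi] satisfies [|Phi (h n)| <= |Phi| (h n) <= |Phi| (f n)]. *)
Lemma weakly_p_summable_le (L : banachLatticeType R) (f h : nat -> L) :
  (forall n, 0 <= h n) -> (forall n, h n <= f n) ->
  weakly_p_summable p f -> weakly_p_summable p h.
Proof.
move=> h0 hf fs Phi; apply: in_ell_le (fs (modulus (Phi : dual L))) => n.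
have M0 : 0 <= modulus (Phi : dual L) by exact: modulus_ge0.
rewrite (le_trans _ (ler_norm _)) //.
apply: (@le_trans _ _ (modulus (Phi : dual L) (h n) : R)); last exact: dual_mono.
have := lerN_modulus (Phi : dual L); have := ler_modulus (Phi : dual L).
rewrite !dual_leE => /asboolP/(_ _ (h0 n)) h1 /asboolP/(_ _ (h0 n)) h2.
by rewrite ler_norml h1 andbT lerNl.
Qed.

Lemma evaluation_functional (V : normedModType R) (y : V) :
  exists Phi : dual (dual V), forall f : dual V, Phi f = f y.
Proof.
have lin : linear (fun f : dual V => f y : R^o) by [].
have bound (f : dual V) : `|f y : R^o| <= `|y| * `|f|.
  by rewrite mulrC; exact: ler_boundedOp.
by exists (BoundedOp lin (linear_bound_continuous lin bound)).
Qed.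
End summable.

(** Diagonal extraction: entries [a (s k) (s j)] with [j < k] can be made as small
    as wished, because each column tends to 0. *)
Lemma extract_small_below (R : realType) (a : nat -> nat -> R) (P : nat -> Prop)
    (eps : nat -> R) :
  (forall j, a n j @[n --> \oo] --> (0 : R^o)) ->
  (forall N, exists2 n, (N < n)%N & P n) ->
  (forall k, 0 < eps k) -> {homo eps : m n / (m <= n)%N >-> n <= m} ->
  exists s : nat -> nat, [/\ {homo s : m n / (m < n)%N}, forall k, P (s k)
    & forall j k, (j < k)%N -> a (s k) (s j) <= eps k].
Proof.
move=> a0 Pinf eps0 epsmono.
have nextN n : exists m, [/\ (n < m)%N, P m &
    forall j, (j <= n)%N -> a m j <= eps n.+1].
  have : \forall m \near \oo, forall j, (j < n.+1)%N -> a m j <= eps n.+1.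
    elim: n.+1 (eps n.+1) (eps0 n.+1) => [|k IH] e e0; first by apply: nearW.
    have /cvgrPdist_le/(_ _ e0) ak := a0 k.
    apply: filterS2 (IH e e0) ak => m akm am j.
    rewrite ltnS leq_eqVlt => /predU1P[->|/akm //].
    by rewrite sub0r normrN in am; exact: le_trans (ler_norm _) am.
  case=> N _ aN; have [m mN Pm] := Pinf (maxn N n).
  move: mN; rewrite gtn_max => /andP[Nm nm].
  by exists m; split => // j jn; apply: aN; [exact: ltnW|].
have [next nextP] := choice nextN; have [n0 _ Pn0] := Pinf 0%N.
pose s k := iter k next n0.
have sS k : (s k < s k.+1)%N by have [] := nextP (s k).
have smono : {homo s : m n / (m < n)%N} by apply: homo_ltn => //; exact: ltn_trans.
have sge k : (k <= s k)%N by elim: k => // k IH; exact: leq_ltn_trans (sS k).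
exists s; split => // [[|k] //|j [//|k]]; first by have [] := nextP (s k).
rewrite ltnS => jk; have [_ _ /(_ (s j)) h] := nextP (s k).
apply: (@le_trans _ _ (eps (s k).+1)); last by apply: epsmono; rewrite ltnS.
by apply: h; move: jk; rewrite leq_eqVlt => /predU1P[->//|/smono/ltnW].
Qed.

Lemma weighted_sum_le (R : realType) (c : R) k (b : nat -> R) : 0 <= c ->
  (forall j, (j < k)%N -> b j <= c * 8 ^- k) -> 4 ^+ k * (\sum_(j < k) b j) <= c.
Proof.
move=> c0 bc.
have h : \sum_(j < k) b j <= \sum_(j < k) c * 8 ^- k.
  by apply: ler_sum => j _; exact: bc.
rewrite sumr_const card_ord in h.
rewrite (le_trans (ler_wpM2l (exprn_ge0 _ _) h)) //.
have -> : 4 ^+ k * ((c * 8 ^- k) *+ k) = c * (k%:R / 2 ^+ k).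
  have -> : (8 : R) ^+ k = 4 ^+ k * 2 ^+ k by rewrite -exprMn -natrM.
  rewrite -mulr_natr.
  by field; rewrite !expf_neq0.
rewrite ler_piMr // ler_pdivrMr ?exprn_gt0 // mul1r -natrX ler_nat ltnW //.
exact: ltn_expl.
Qed.

(** Functionals [f n] that witness the failure are made disjoint without losing
    more than a fraction of their norms: vectors nearly norming them are made
    disjoint, and each [f n] is replaced by its component carried by its new
    vector. *)
Lemma not_positive_schur (R : realType) (p : R) (F : banachLatticeType R) :
  1 <= p -> ~ positive_schur_property p (dual F) ->
  exists (h : nat -> dual F) (z : nat -> F) (c : R),
    [/\ 0 < c, disjoint_seq h, weakly_p_summable p h,
       forall n, 0 <= h n & forall n, [/\ 0 <= z n & `|z n| <= 1]]
    /\ \forall n \near \oo, c <= (h n (z n) : R).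
Proof.
move=> p1 /existsNP[f /not_implyP[f0 /not_implyP[fs fn0]]].
have [e [e0 fe]] : exists e : R,
    0 < e /\ forall N, exists2 n, (N < n)%N & e <= `|f n|.
  apply: contrapT => /forallNP noe; apply: fn0; apply/cvgr0Pnorm_lt => e e0.
  have /not_andP[//|/existsNP[N /forall2NP fN]] := noe e.
  exists N.+1 => // n /= Nn; rewrite ltNge; apply/negP => en.
  by have [] := fN n.
have y_ n : exists y : F,
    [/\ 0 <= y, `|y| <= 1 & e <= `|f n| -> e / 2 <= (f n y : R)].
  have [en|_] := boolP (e <= `|f n|); last by exists 0; rewrite normr0.
  by have [y [y0 y1 fy]] := dual_ge0_norming e0 (f0 n) en; exists y.
have {y_}[y yP] := choice y_.
have fcvg0 x : f n x @[n --> \oo] --> (0 : R^o).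
  have [Phi PhiE] := evaluation_functional x.
  by have := in_ell_cvg0 p1 (fs Phi); under eq_fun do rewrite PhiE.
(* A quarter of [f n (u n) >= e / 2] may be lost to the earlier terms: the entries
   are at most [e / 8 * 8^-k], there are [k <= 2^k] of them, and [disjointify]
   weights their sum by [4^k].  The term [2^-k Y] costs another [e / 8] at most,
   but only from some index on. *)
have e8 k : 0 < e / 8 * 8 ^- k by rewrite mulr_gt0 ?divr_gt0 ?invr_gt0 ?exprn_gt0.
have e8mono : {homo (fun k => e / 8 * 8 ^- k) : m n / (m <= n)%N >-> n <= m}.
  move=> m n mn /=; rewrite ler_wpM2l ?divr_ge0 ?(ltW e0) //.
  by rewrite lef_pV2 ?posrE ?exprn_gt0 // ler_eXn2l ?ltr1n.
have [s [smono sP sy]] := extract_small_below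
  (a := fun n j => f n (y j)) (P := fun n => e <= `|f n|)
  (fun j => fcvg0 (y j)) fe e8 e8mono.
pose u k := y (s k).
have u0 k : 0 <= u k by have [] := yP (s k).
have u1 k : `|u k| <= 1 by have [] := yP (s k).
have half0 k : 0 <= (2 : R) ^- k by rewrite invr_ge0 exprn_ge0.
have half_cvg : cvgn (series (fun k => 2 ^- k : R)).
  have -> : (fun k => 2 ^- k) = geometric 1 (2^-1 : R).
    by apply/funext => k; rewrite /= mul1r exprVn.
  by apply: is_cvg_geometric_series; rewrite ger0_norm ?invr_ge0 // invf_lt1 ?ltr1n.
pose Y := wsum u (fun k => 2 ^- k).
have uY k : 2 ^- k *: u k <= Y by exact: (wsum_ge (c := fun k => 2 ^- k)).
have Y0 : 0 <= Y by rewrite (le_trans _ (uY 0)) // bl_scaler_ge0.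
pose z := disjointify u Y.
have z0 k : 0 <= z k by exact: disjointify_ge0.
have z1 k : `|z k| <= 1.
  by rewrite (le_trans _ (u1 k)) // bl_norm_le // disjointify_le.
have [h hE] := choice (fun k => carried_functional (z k) (f0 (s k))).
have hb k x : 0 <= x -> 0 <= (h k x : R) <= f (s k) x.
  by move=> x0; rewrite hE //; exact: carried_bounds.
have h0 k : 0 <= h k by apply/dual_ge0P => x x0; have /andP[] := @hb k x x0.
exists h, z, (e / 8); split; last first.
  have /cvgr0Pnorm_lt/(_ (e / 8)) : f (s k) Y @[k --> \oo] --> (0 : R^o).
    have [Phi PhiE] := evaluation_functional Y.
    have := in_ell_cvg0 p1 (in_ell_subseq smono (fs Phi)).
    by under eq_fun do rewrite /= PhiE.
  rewrite divr_gt0 // => /(_ isT); apply: filterS => k fY.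
  have fz : (f (s k) (z k) : R) <= h k (z k).
    by rewrite hE // (@le_carried _ _ _ (z k) (f0 (s k)) _ _ 1) // scale1r.
  apply: (le_trans _ fz).
  apply: (le_trans _ (dual_mono (f0 (s k)) (leUl _ _))).
  rewrite !linearB /= !linearZ /= linear_sum /=.
  have fu : e / 2 <= (f (s k) (u k) : R) by have [_ _] := yP (s k); apply.
  have e8' : 0 <= e / 8 by rewrite divr_ge0 // ltW.
  have fsum := weighted_sum_le (b := fun j => f (s k) (u j)) e8'
    (fun j => sy j k).
  have fY' : 2 ^- k * (f (s k) Y : R) <= e / 8.
    rewrite (le_trans _ (ltW fY)) // (le_trans _ (ler_norm _)) // ler_piMl //.
      by have /dual_ge0P -> := f0 (s k).
    by rewrite invf_le1 ?exprn_gt0 // exprn_ege1 // ler1n.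
  rewrite !scalerN; move: fu fsum fY'; rewrite /GRing.scale /=; lra.
split => //.
- by rewrite divr_gt0.
- move=> n m nm; apply: (carried_disjoint (f0 (s n)) (f0 (s m)) (z0 n) (z0 m) _ (hE n) (hE m)).
  exact: disjointify_disjoint.
- apply: (@weakly_p_summable_le _ _ p1 (dual F) (f \o s)) => // [k|Phi].
    by rewrite dual_leE; apply/asboolP => x x0; have /andP[] := @hb k x x0.
  exact: in_ell_subseq smono (fs Phi).
Qed.

(** * The theorem *)

Unset Implicit Arguments.
Theorem theorem3p6 (R : realType) (p : R) (hp : 1 <= p)
    (E F : banachLatticeType R)
    (hT : forall T : boundedOp E F,
       positive_op T -> order_weakly_compact T ->
       disjoint_p_convergent p (adjoint T)) :
  order_continuous_norm (dual E) \/ positive_schur_property p (dual F).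
Proof.
apply: contrapT => /not_orP[/not_order_continuous_norm[g [phi [e [e0 g0 gphi ge]]]]].
move=> /(not_positive_schur hp)[h [z [c [[c0 hd hs h0 z01] hz]]]].
have z0 k : 0 <= z k by have [] := z01 k.
have z1 k : `|z k| <= 1 by have [] := z01 k.
pose T := ell1_op g0 gphi z1.
have Tpos : positive_op T by exact: ell1_op_positive.
have Towc : order_weakly_compact T by exact: ell1_op_order_weakly_compact.
have := hT T Tpos Towc h hd hs.
have ec : 0 < e / 2 * c by rewrite mulr_gt0 // divr_gt0.
move=> /cvgr0Pnorm_lt/(_ _ ec) Th.
have [n [/= hzn]] := filter_ex (filterI hz Th).
apply/negP; rewrite -leNgt.
have [x [x0 x1 gx]] := dual_ge0_norming e0 (g0 n) (ge n).
have Tx : `|adjoint T (h n) x : R| <= `|adjoint T (h n)|.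
  by rewrite (le_trans (ler_boundedOp _ _)) // ler_piMr.
apply: (le_trans _ Tx); apply: (le_trans _ (ler_norm _)) => /=.
apply: (le_trans _ (dual_mono (h0 n) (@ell1_op_ge _ _ _ _ _ _ g0 gphi z0 z1 x n x0))).
by rewrite linearZ ler_pM // ltW // divr_gt0.
Qed.
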